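(* Let $k\ge 3$, $1\le s\le k$, $\mathbf n=(n_1,\dots,n_k)$ positive integers and $r\le\min\{n_1,\dots,n_k\}$. For a generic tensor $\mathcal T\in\mathbb R^{n_1}\otimes\cdots\otimes\mathbb R^{n_k}$, every critical projection of $\mathcal T$ on $P_s(\mathbf n,r)$ lies in $R_s(\mathbf n,r)$.
   Context: $P_s(\mathbf n,r)$ is the set of tensors $\sum_{i=1}^r\sigma_i\mathbf a^{(1)}_i\otimes\cdots\otimes\mathbf a^{(k)}_i$ with $\sigma_i\in\mathbb R$, all $\mathbf a^{(l)}_i\in\mathbb R^{n_l}$ unit vectors, and for each $l\le s$ the vectors $\mathbf a^{(l)}_1,\dots,\mathbf a^{(l)}_r$ pairwise orthogonal; it is a real algebraic subset of the tensor space. $R_s(\mathbf n,r)\subseteq P_s(\mathbf n,r)$ is the set of those tensors admitting such a decomposition in which all $\sigma_i\ne0$ and for each $l=s+1,\dots,k$ the matrix $[\mathbf a^{(l)}_1,\dots,\mathbf a^{(l)}_r]$ has full column rank $r$. For a real algebraic set $Y\subseteq\mathbb R^N$ whose vanishing ideal is generated by $f_1,\dots,f_m$, the Zariski tangent space at $\mathbf y\in Y$ is $T_Y(\mathbf y)=\ker J_{\mathbf y}(f_1,\dots,f_m)$ (kernel of the Jacobian matrix); a point $\mathbf y_0\in Y$ is a critical projection of $\mathbf x\in\mathbb R^N$ to $Y$ if $\langle\mathbf v,\mathbf x-\mathbf y_0\rangle=0$ for all $\mathbf v\in T_Y(\mathbf y_0)$ (with the tensor space identified with $\mathbb R^N$,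 Hilbert–Schmidt inner product). ''Generic'' means: outside a proper real algebraic subset (in particular outside a Lebesgue-null set). *)

(* Defs.v *)
From HB Require Import structures.
From mathcomp Require Import all_boot all_order all_algebra.
From mathcomp Require Import reals.
From mathcomp Require Import mpoly.
Set Implicit Arguments. Unset Strict Implicit. Unset Printing Implicit Defensive.
Import Order.TTheory GRing.Theory Num.Theory.
Local Open Scope ring_scope.

(* Multi-indices of the tensor space R^{n_1} (x) ... (x) R^{n_k}
   (modes are 0-based: mode l : 'I_k has dimension n l). *)
Definition midx (k : nat) (n : 'I_k -> nat) : finType :=
  {dffun forall l : 'I_k, 'I_(n l)}.

Definition tensor (R : realType) (k : nat) (n : 'I_k -> nat) :=
  midx n -> R.

Definition tvec (R : realType) k (n : 'I_k -> nat) (T : tensor R n) :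
  'I_#|midx n| -> R := fun i => T (enum_val i).

Definition hs (R : realType) k (n : 'I_k -> nat) (T U : tensor R n) : R :=
  \sum_(x : midx n) T x * U x.

Definition tpoly (R : realType) k (n : 'I_k -> nat) := {mpoly R[#|midx n|]}.

Definition teval (R : realType) k (n : 'I_k -> nat) (f : tpoly R n)
  (T : tensor R n) : R := f.@[tvec T].

Definition vanishing_ideal (R : realType) k (n : 'I_k -> nat)
  (Y : tensor R n -> Prop) (f : tpoly R n) : Prop :=
  forall T, Y T -> teval f T = 0.

(* Zariski tangent space T_Y(y): the common kernel of the differentials at y
   of all polynomials of the vanishing ideal (= kernel of the Jacobian of any
   finite generating family of that ideal). *)
Definition zariski_tangent (R : realType) k (n : 'I_k -> nat)
  (Y : tensor R n -> Prop) (y v : tensor R n) : Prop :=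
  forall f : tpoly R n, vanishing_ideal Y f ->
    \sum_(i < #|midx n|) (mderiv i f).@[tvec y] * tvec v i = 0.

Definition critical_projection (R : realType) k (n : 'I_k -> nat)
  (Y : tensor R n -> Prop) (x y0 : tensor R n) : Prop :=
  Y y0 /\ forall v, zariski_tangent Y y0 v ->
    hs v (fun i => x i - y0 i) = 0.

Definition unit_vec (R : realType) (m : nat) (a : 'I_m -> R) : Prop :=
  \sum_(j < m) a j ^+ 2 = 1.

Definition orth (R : realType) (m : nat) (a b : 'I_m -> R) : Prop :=
  \sum_(j < m) a j * b j = 0.

Definition cp_tensor (R : realType) k (n : 'I_k -> nat) (r : nat)
  (sigma : 'I_r -> R) (a : forall l : 'I_k, 'I_r -> 'I_(n l) -> R) :
  tensor R n :=
  fun x => \sum_(i < r) sigma i * \prod_(l < k) a l i (x l).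

(* Admissible decomposition for P_s(n, r): all factor vectors are unit,
   and the factor vectors of modes 1..s (0-based: l < s) are pairwise
   orthogonal. *)
Definition P_decomp (R : realType) k (n : 'I_k -> nat) (s r : nat)
  (sigma : 'I_r -> R) (a : forall l : 'I_k, 'I_r -> 'I_(n l) -> R) : Prop :=
  (forall (l : 'I_k) (i : 'I_r), unit_vec (a l i)) /\
  (forall (l : 'I_k) (i i' : 'I_r), (l < s)%N -> i != i' ->
     orth (a l i) (a l i')).

Definition Ps (R : realType) k (n : 'I_k -> nat) (s r : nat)
  (T : tensor R n) : Prop :=
  exists (sigma : 'I_r -> R) (a : forall l : 'I_k, 'I_r -> 'I_(n l) -> R),
    P_decomp s sigma a /\ T = cp_tensor sigma a.

(* R_s(n, r): admits such a decomposition with all sigma_i <> 0 and, for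
   the modes s+1..k (0-based: s <= l), the n_l x r factor matrix
   [a^(l)_1, ..., a^(l)_r] of full column rank r. *)
Definition Rs (R : realType) k (n : 'I_k -> nat) (s r : nat)
  (T : tensor R n) : Prop :=
  exists (sigma : 'I_r -> R) (a : forall l : 'I_k, 'I_r -> 'I_(n l) -> R),
    [/\ P_decomp s sigma a, T = cp_tensor sigma a,
        (forall i, sigma i != 0) &
        (forall l : 'I_k, (s <= l)%N ->
           \rank (\matrix_(j < n l, i < r) a l i j) = r)].

(* Main.v *)
Require Import Defs.
From HB Require Import structures.
From mathcomp Require Import all_boot all_order all_algebra.
From mathcomp Require Import boolp classical_sets filter.
From mathcomp Require Import reals.
From mathcomp Require Import mpoly ring.
Import Order.TTheory GRing.Theory Num.Theory.
Local Open Scope ring_scope.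

(** Let f_1, ..., f_m generate the vanishing ideal of Y = P_s (Hilbert). If y is
    a critical projection of T, then T = y + sum_l c_l grad f_l(y). Were the bad T
    Zariski dense, an ultrafilter on the bad data would make T generic, and every
    partial derivative d/dT_j would extend to y and c (derivations extend along
    field extensions in characteristic 0). Write D for the resulting matrix
    (dy_i / dT_j), G for the Jacobian of f and S for the symmetric matrix
    sum_l c_l Hess f_l(y). Then G D^T = 0 and 1 = D (1 + S) + C G, which forces D
    to be symmetric and gives w = D (1 + S) w for every w in ker G.

    When y lies in P_s but not in R_s, some mode has a flattening of y whose rank
    drops below r, and y + t w stays in P_s for a w that does not map the kernel
    of this flattening into its image: there are vectors u, z with
    z in the kernel, u orthogonal to the image and <u (x) z, w> <> 0. Differentiating
    the relation <u (x) z, y> = 0 gives D (u (x) z) = 0, whence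
    <u (x) z, w> = <u (x) z, D (1 + S) w> = 0, a contradiction. *)

Set Implicit Arguments. Unset Strict Implicit. Unset Printing Implicit Defensive.

(** * Noetherianity of multivariate polynomial rings *)

(** Passing to a subsequence keeps earlier coordinates nondecreasing, so those in [s] are treated
    one at a time. For a new one, each chosen index realizes the minimum over a tail containing all
    later choices. *)
Lemma nondecreasing_subseq (I : eqType) (u : I -> nat -> nat) (s : seq I) :
  exists phi : nat -> nat, {homo phi : i j / (i < j)%N} /\
    {in s, forall a, {homo u a \o phi : i j / (i <= j)%N}}.
Proof.
elim: s => [|a s [phi [phi_lt phi_s]]]; first by exists id; split=> // a.
have argmin N : exists i, (N <= i)%N /\
    forall j, (N <= j)%N -> (u a (phi i) <= u a (phi j))%N.
  pose P v := `[< exists2 i, (N <= i)%N & u a (phi i) = v >].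
  have exP : exists v, P v by exists (u a (phi N)); apply/asboolP; exists N.
  case: (ex_minnP exP) => v /asboolP[i Ni <-] vmin.
  by exists i; split=> // j Nj; apply: vmin; apply/asboolP; exists j.
have [g gP] := choice argmin.
(* [g i.+1] searches strictly past the previous index [i], which makes [psi] strictly increasing. *)
pose psi k := iter k (fun i => g i.+1) (g 0%N).
have psi_lt : {homo psi : i j / (i < j)%N}.
  apply: homo_ltn => [|i]; first exact: ltn_trans.
  by have [] := gP (psi i).+1.
exists (phi \o psi); split=> [i j ij|b]; first exact/phi_lt/psi_lt.
have psi_le : {homo psi : i j / (i <= j)%N}.
  by move=> i j; rewrite leq_eqVlt => /orP[/eqP->//|/psi_lt/ltnW].
rewrite inE => /predU1P[->|/phi_s vphi] i j ij /=; last exact/vphi/psi_le.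
case: i ij => [|i] ij.
  by have [_] := gP 0%N; apply.
by have [lei] := gP (psi i).+1; apply; apply: leq_trans lei (psi_le _ _ ij).
Qed.

Lemma dickson n (m : nat -> 'X_{1..n}) :
  exists i j, (i < j)%N /\ (m i <= m j)%MM.
Proof.
have [phi [phi_lt phi_le]] :=
  nondecreasing_subseq (fun (i : 'I_n) k => m k i) (enum 'I_n).
exists (phi 0%N), (phi 1%N); split; first exact: phi_lt.
by apply/mnm_lepP => i; apply: phi_le; rewrite ?mem_enum.
Qed.

Section Hilbert.
Variables (K : fieldType) (n : nat) (I : {mpoly K[n]} -> Prop).
Hypothesis ID : forall f g, I f -> I g -> I (f + g).
Hypothesis IM : forall h f, I f -> I (h * f).

(** Otherwise elements of [I] could be chosen forever, each with a leading monomial divisible by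
    none of the earlier ones, contrary to [dickson]. *)
Lemma lead_basis : exists2 F : seq {mpoly K[n]},
  (forall g, g \in F -> I g /\ g != 0) &
  forall f, I f -> f != 0 -> exists2 g, g \in F & (mlead g <= mlead f)%MM.
Proof.
apply: contrapT => noF.
(* The condition on [F] stands under the existential so that [choice] gives a function on all lists;
   for the other lists 0 is a dummy value. *)
have next (F : seq {mpoly K[n]}) : exists f,
    (forall g, g \in F -> I g /\ g != 0) ->
    [/\ I f, f != 0 & forall g, g \in F -> ~~ (mlead g <= mlead f)%MM].
  have [FI|nFI] := pselect (forall g, g \in F -> I g /\ g != 0); last by exists 0.
  apply: contrapT => nof; apply: noF; exists F => // f If f0.
  apply: contrapT => nog; apply: nof; exists f => _; split=> // g gF.
  by apply/negP => le_gf; apply: nog; exists g.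
have [nxt nxtP] := choice next.
pose L k := iter k (fun F => rcons F (nxt F)) [::].
have LI k g : g \in L k -> I g /\ g != 0.
  elim: k g => [//|k IH] g; rewrite /= mem_rcons inE => /orP[/eqP->|/IH//].
  by have [] := nxtP (L k) IH.
have memL i j : (i < j)%N -> nxt (L i) \in L j.
  elim: j => // j IH; rewrite ltnS leq_eqVlt mem_rcons inE.
  by case/orP=> [/eqP->|/IH->]; rewrite ?eqxx ?orbT.
have [i [j [/memL ij le_ij]]] := dickson (fun k => mlead (nxt (L k))).
have [_ _ /(_ _ ij)] := nxtP (L j) (LI j).
by rewrite le_ij.
Qed.

(** Multivariate division by the list of [lead_basis]: induction on the leading monomial, cancelling
    the leading term of [f] by a monomial multiple [q * g]. *)
Theorem hilbert_basis : exists m (F : 'I_m -> {mpoly K[n]}),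
  (forall j, I (F j)) /\
  forall f, I f -> exists h : 'I_m -> {mpoly K[n]}, f = \sum_j h j * F j.
Proof.
have [F FI Flead] := lead_basis.
exists (size F), (fun j => F`_j); split=> [j|].
  by have [] := FI F`_j (mem_nth _ (ltn_ord j)).
elim/mleadrect=> f IH If.
have [->|f0] := eqVneq f 0.
  by exists (fun=> 0); rewrite big1 // => j _; rewrite mul0r.
have [g gF le_gf] := Flead f If f0; have [Ig g0] := FI g gF.
pose q := (mleadc f / mleadc g) *: 'X_[mlead f - mlead g].
have lg0 : mleadc g != 0 by rewrite mleadc_eq0.
have lf0 : mleadc f != 0 by rewrite mleadc_eq0.
have c0 : mleadc f / mleadc g != 0 by rewrite mulf_neq0 ?invr_eq0.
have q0 : q != 0.
  by rewrite /q scaler_eq0 negb_or c0 -mleadc_eq0 mleadXm mcoeffX eqxx oner_eq0.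
have lq : mlead q = (mlead f - mlead g)%MM by rewrite /q mleadZ // mleadXm.
have lqg : mlead (q * g) = mlead f by rewrite mleadM // lq submK.
have lcqg : mleadc (q * g) = mleadc f.
  rewrite mleadcM_proper ?mulf_neq0 ?mleadc_eq0 //.
  by rewrite lq /q mcoeffZ mcoeffX eqxx mulr1 divfK.
have If' : I (f - q * g).
  by apply: ID => //; rewrite -mulNr; apply: IM.
have jP : (index g F < size F)%N by rewrite index_mem.
suff [h hE] : exists h : 'I_(size F) -> {mpoly K[n]},
    f - q * g = \sum_j h j * F`_j.
  exists (fun j => h j + (if j == Ordinal jP then q else 0)).
  rewrite -(subrK (q * g) f) hE.
  under [RHS]eq_bigr do rewrite mulrDl.
  rewrite big_split /=; congr (_ + _).
  rewrite (bigD1 (Ordinal jP)) //= eqxx nth_index // big1 ?addr0 // => j.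
  by move/negPf->; rewrite mul0r.
have [->|f'0] := eqVneq (f - q * g) 0.
  by exists (fun=> 0); rewrite big1 // => j _; rewrite mul0r.
apply: IH => //.
have : (mlead (f - q * g) <= mlead f)%O.
  by apply: le_trans (mleadB_le _ _) _; rewrite lqg joinxx.
rewrite le_eqVlt => /orP[/eqP eqf|//].
move: f'0; rewrite -mleadc_eq0 eqf mcoeffB -{2}lqg lcqg subrr eqxx //.
Qed.
End Hilbert.

(** * Extension of derivations modulo an ultrafilter *)

Section PointwiseDerivation.
Variables (K : numFieldType) (X : Type).

(** A ring of expressions together with, at each point x of X, its evaluation in K
    and a derivation along this evaluation. [der_ae0] says that modulo U the
    derivation only depends on the value, so that it stands for a derivation from
    the subring of the ultraproduct K^X / U generated by the expressions; working
    with expressions avoids building that field. *)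
Record dring (U : set_system X) := DRing {
  carrier :> idomainType;
  ev : X -> {rmorphism carrier -> K};
  der : X -> {additive carrier -> K};
  cst : {rmorphism K -> carrier};
  derM : forall x a b, der x (a * b) = der x a * ev x b + ev x a * der x b;
  ev_cst : forall x c, ev x (cst c) = c;
  der_cst : forall x c, der x (cst c) = 0;
  der_ae0 : forall a, U (fun x => ev x a = 0) -> U (fun x => der x a = 0) }.

Lemma ultra_em (U : set_system X) (UF : UltraFilter U) (A : X -> Prop) :
  U A \/ U (fun x => ~ A x).
Proof. exact: in_ultra_setVsetC. Qed.

Section Adjoin.
Variables (U : set_system X) (B : dring U) (h d : X -> K).

Definition adj_ev x : {rmorphism {poly B} -> K} :=
  horner_eval (h x) \o map_poly (ev B x).

(** The extension to [{poly B}] of the derivation of [B] that sends the indeterminate to [d x]. *)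
Definition adj_der x (p : {poly B}) : K :=
  (map_poly (der B x) p).[h x] + (map_poly (ev B x) p^`()).[h x] * d x.

Fact adj_der_is_additive x : zmod_morphism (adj_der x).
Proof.
by move=> p q; rewrite /adj_der derivB !rmorphB !raddfB /= !hornerE mulrBl addrACA opprD.
Qed.

HB.instance Definition _ x :=
  GRing.isZmodMorphism.Build {poly B} K (adj_der x) (adj_der_is_additive x).

Fact adj_derM x p q :
  adj_der x (p * q) = adj_der x p * adj_ev x q + adj_ev x p * adj_der x q.
Proof.
have mapM : map_poly (der B x) (p * q) =
    map_poly (der B x) p * map_poly (ev B x) q +
    map_poly (ev B x) p * map_poly (der B x) q.
  apply/polyP => i; rewrite coefD !coefM coef_map coefM raddf_sum -big_split /=.
  by apply: eq_bigr => j _; rewrite !coef_map /= derM.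
rewrite /adj_der /adj_ev /= /horner_eval mapM derivM rmorphD !rmorphM /= !hornerE.
rewrite !(mulrDl, mulrDr) !mulrA -!addrA; congr (_ + _).
by rewrite [RHS]addrC -!addrA; congr (_ + _); rewrite addrC mulrAC.
Qed.

Fact adj_ev_cst x c : adj_ev x (cst B c)%:P = c.
Proof. by rewrite /adj_ev /= /horner_eval map_polyC hornerC /= ev_cst. Qed.

Fact adj_derC x c : adj_der x c%:P = der B x c.
Proof.
by rewrite /adj_der derivC rmorph0 horner0 mul0r addr0 map_polyC hornerC.
Qed.

Fact adj_der_cst x c : adj_der x (cst B c)%:P = 0.
Proof. by rewrite adj_derC der_cst. Qed.

(** Derivatives of coefficients vanish modulo U by [der_ae0], and since the coefficients are
    finitely many, one set of U serves them all. *)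
Lemma adj_der_ae (UF : Filter U) (p : {poly B}) :
  (forall i, U (fun x => ev B x p`_i = 0)) -> U (fun x => adj_der x p = 0).
Proof.
move=> p0.
have: U (fun x => forall i : 'I_(size p), ev B x p`_i = 0 /\ der B x p`_i = 0).
  apply: filter_forall => i; have e0 := p0 i; have d0 := der_ae0 e0.
  exact: filterI.
apply: filterS => x px0; rewrite /adj_der.
have -> : map_poly (der B x) p = 0.
  apply/polyP => i; rewrite coef_map coef0 /=.
  have [ip|pi] := ltnP i (size p); first by have [] := px0 (Ordinal ip).
  by rewrite nth_default ?raddf0.
have -> : map_poly (ev B x) p^`() = 0.
  apply/polyP => i; rewrite coef_map coef0 /= coef_deriv rmorphMn /=.
  have [ip|pi] := ltnP i.+1 (size p).
    by have [/= -> _] := px0 (Ordinal ip); rewrite mul0rn.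
  by rewrite nth_default ?rmorph0 ?mul0rn.
by rewrite !horner0 mul0r addr0.
Qed.

Definition adj_dring
  (compat : forall p : {poly B}, U (fun x => adj_ev x p = 0) ->
     U (fun x => adj_der x p = 0)) : dring U :=
  @DRing U {poly B} adj_ev (fun x => adj_der x : {additive {poly B} -> K})
    (polyC \o cst B : {rmorphism K -> {poly B}})
    adj_derM adj_ev_cst adj_der_cst compat.
End Adjoin.

Arguments adj_ev {U} B h x.
Arguments adj_der {U} B h d x p.

(** Extension of a derivation along a simple field extension in characteristic 0. The only choice is
    the derivative [d] of [h], which must respect every polynomial relation satisfied by [h] modulo
    U. *)
Lemma adjoin (U : set_system X) (UF : UltraFilter U) (B : dring U) (h : X -> K) :
  exists (C : dring U) (i : B -> C) (b : C),
    [/\ forall x a, ev C x (i a) = ev B x a,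
        forall x a, der C x (i a) = der B x a &
        forall x, ev C x b = h x].
Proof.
suff [d compat] : exists d, forall p : {poly B}, U (fun x => adj_ev B h x p = 0) ->
     U (fun x => adj_der B h d x p = 0).
  exists (adj_dring compat), polyC, 'X; split=> [x a|x a|x] /=.
  - by rewrite /adj_ev /= /horner_eval map_polyC hornerC.
  - exact: adj_derC.
  - by rewrite /adj_ev /= /horner_eval map_polyX hornerX.
have F : ProperFilter U by exact: ultra_proper.
(* A relation of size [n] for [h] that is nontrivial: some coefficient does not vanish modulo U. *)
pose rel n := exists p : {poly B}, [/\ size p = n, U (fun x => adj_ev B h x p = 0) &
  exists i, ~ U (fun x => ev B x p`_i = 0)].
(* If h is transcendental over the values of B, any d will do. *)
have [[n0 reln0]|norel] := pselect (exists n, rel n); last first.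
  exists (fun=> 0) => p p0; apply: adj_der_ae => i.
  by apply: contrapT => pi; apply: norel; exists (size p), p; split=> //; exists i.
have exn : exists n, `[< rel n >] by exists n0; apply/asboolP.
case: (ex_minnP exn) => n /asboolP[q [sq q0 [i0 qi0]]] nmin.
have small (p : {poly B}) : (size p < n)%N -> U (fun x => adj_ev B h x p = 0) ->
    forall i, U (fun x => ev B x p`_i = 0).
  move=> pn p0 i; apply: contrapT => pi.
  suff /nmin : `[< rel (size p) >] by rewrite leqNgt pn.
  by apply/asboolP; exists p; split=> //; exists i.
have qn0 : q != 0.
  apply/eqP => qE; apply: qi0; rewrite qE.
  by apply: filterS filterT => x _; rewrite coef0 rmorph0.
(* Otherwise dropping the leading term of [q] would leave a shorter nontrivial relation. *)
have lq : ~ U (fun x => ev B x (lead_coef q) = 0).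
  move=> lq0; pose t := q - lead_coef q *: 'X^((size q).-1).
  have tE i : t`_i = if i == (size q).-1 then 0 else q`_i.
    rewrite /t coefB coefZ coefXn; case: eqP => [->|_].
      by rewrite mulr1 subrr.
    by rewrite mulr0 subr0.
  have st : (size t < n)%N.
    rewrite -sq -(prednK (n := size q)) ?size_poly_gt0 // ltnS.
    apply/leq_sizeP => j; rewrite tE leq_eqVlt eq_sym => /orP[->//|ji].
    case: ifP => // _; apply/(leq_sizeP _ _ (leqnn _)).
    by rewrite -(prednK (n := size q)) ?size_poly_gt0.
  apply: qi0; have [->//|ni0] := eqVneq i0 (size q).-1.
  have := small t st _ i0; rewrite tE (negPf ni0); apply.
  apply: filterS2 q0 lq0 => x qx lx.
  rewrite [LHS]rmorphB qx /adj_ev /= /horner_eval map_polyZ /= lx.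
  by rewrite scale0r horner0 subr0.
have sq1 : (1 < size q)%N.
  rewrite ltnNge; apply/negP => /size1_polyC qE; apply: lq.
  apply: filterS q0 => x; rewrite qE /adj_ev /= /horner_eval map_polyC hornerC.
  by rewrite lead_coefC.
(* Separability: the derivative of [q] is shorter than [q], and its top coefficient is [lead_coef q]
   times a positive integer, so it cannot be a relation. *)
have q'0 : U (fun x => adj_ev B h x q^`() <> 0).
  have [q'0|//] := ultra_em UF (fun x => adj_ev B h x q^`() = 0).
  exfalso; apply: lq.
  have sq' : (size q^`() < n)%N by rewrite -sq lt_size_deriv.
  apply: filterS (small _ sq' q'0 (size q).-2) => x.
  rewrite coef_deriv prednK; last by rewrite -subn1 subn_gt0.
  rewrite rmorphMn /= -mulr_natr => /eqP.
  rewrite mulf_eq0 pnatr_eq0; case/orP => [/eqP//|/eqP s0].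
  by move: sq1; rewrite -(prednK (n := size q)) ?size_poly_gt0 // s0.
(* Otherwise q plays the role of the minimal polynomial of h, and d is forced by
   differentiating q(h) = 0; pseudo-division by q handles the other relations. *)
have {}lq : U (fun x => ev B x (lead_coef q) <> 0).
  by have [|] := ultra_em UF (fun x => ev B x (lead_coef q) = 0).
pose d x := - (map_poly (der B x) q).[h x] / adj_ev B h x q^`().
exists d => p p0.
have dq0 : U (fun x => adj_der B h d x q = 0).
  apply: filterS q'0 => x /eqP qx.
  by rewrite /adj_der /d /adj_ev /= /horner_eval mulrC divfK // subrr.
(* The remainder is a relation shorter than [q], hence trivial with zero derivative. Differentiating
   the identity leaves a power of [lead_coef q] times the derivative of [p]. *)
have eqn := Pdiv.Idomain.divp_eq p q.
set k := scalp p q in eqn.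
have ltr : (size (p %% q)%R < n)%N by rewrite -sq Pdiv.Idomain.ltn_modp.
have r0 : U (fun x => adj_ev B h x (p %% q) = 0).
  apply: filterS2 p0 q0 => x px qx.
  have := congr1 (adj_ev B h x) eqn.
  by rewrite -mul_polyC rmorphM px mulr0 rmorphD rmorphM qx mulr0 add0r => ->.
have dr0 : U (fun x => adj_der B h d x (p %% q) = 0).
  exact: adj_der_ae (small _ ltr r0).
have fin x : ev B x (lead_coef q) <> 0 -> adj_ev B h x p = 0 -> adj_ev B h x q = 0 ->
    adj_der B h d x q = 0 -> adj_der B h d x (p %% q) = 0 -> adj_der B h d x p = 0.
  move=> /eqP lx px qx dqx drx.
  have := congr1 (adj_der B h d x) eqn.
  rewrite -mul_polyC adj_derM px mulr0 add0r raddfD /= adj_derM qx dqx drx.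
  rewrite !mulr0 !addr0 => /eqP; rewrite mulf_eq0 => /orP[|/eqP//].
  by rewrite /adj_ev /= /horner_eval map_polyC hornerC /= rmorphXn expf_eq0 (negPf lx) andbF.
have H : U (fun x => (ev B x (lead_coef q) <> 0 /\ adj_ev B h x p = 0) /\
  adj_ev B h x q = 0 /\ adj_der B h d x q = 0 /\ adj_der B h d x (p %% q) = 0).
  by do ?apply: filterI.
by apply: filterS H => x [[? ?] [? [? ?]]]; apply: fin.
Qed.

Lemma adjoin_seq (U : set_system X) (UF : UltraFilter U) (B : dring U)
    (I : eqType) (h : I -> X -> K) (s : seq I) :
  exists (C : dring U) (i : B -> C) (b : I -> C),
    [/\ forall x a, ev C x (i a) = ev B x a,
        forall x a, der C x (i a) = der B x a &
        {in s, forall j x, ev C x (b j) = h j x}].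
Proof.
elim: s => [|j s [C [i [b [evi deri evb]]]]].
  by exists B, id, (fun=> 0); split.
have [C' [i' [c [evi' deri' evc]]]] := adjoin UF C (h j).
exists C', (i' \o i), (fun l => if l == j then c else i' (b l)); split=> [x a|x a|l].
- by rewrite /= evi' evi.
- by rewrite /= deri' deri.
rewrite inE; case: eqP => [-> _ x|_ /= ls x]; first exact: evc.
by rewrite evi' evb.
Qed.

Section Base.
Variables (U : set_system X) (N : nat) (T : X -> 'I_N -> K) (j : 'I_N).
Hypothesis UF : ProperFilter U.
Hypothesis generic : forall g : {mpoly K[N]}, g != 0 ->
  U (fun x => g.@[T x] != 0).

Fact base_derM x (a b : {mpoly K[N]}) :
  (mderiv j (a * b)).@[T x] =
  (mderiv j a).@[T x] * b.@[T x] + a.@[T x] * (mderiv j b).@[T x].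
Proof. by rewrite mderivM mevalD !mevalM. Qed.

(** By genericity of [T], only the zero polynomial vanishes at [T] modulo U. *)
Fact base_ae0 (a : {mpoly K[N]}) :
  U (fun x => a.@[T x] = 0) -> U (fun x => (mderiv j a).@[T x] = 0).
Proof.
have [->|/generic a0 a0'] := eqVneq a 0.
  by rewrite mderiv0 => _; apply: filterS filterT => x _; rewrite meval0.
exfalso; apply: (filter_not_empty U).
by apply: filterS2 a0 a0' => x /eqP.
Qed.

Fact base_der_cst x (c : K) : (mderiv j c%:MP_[N]).@[T x] = 0.
Proof. by rewrite mderivC meval0. Qed.

Definition base_dring : dring U :=
  @DRing U {mpoly K[N]} (fun x => meval (T x))
    (fun x => meval (T x) \o mderiv j) (@mpolyC N K)
    base_derM (fun x c => mevalC (T x) c) base_der_cst base_ae0.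
End Base.

(** Chain rule: both sides obey the Leibniz rule, so constants and variables suffice. *)
Lemma der_mmap (U : set_system X) (B : dring U) (n : nat) (b : 'I_n -> B)
    (f : {mpoly K[n]}) x :
  der B x (mmap (cst B) b f) =
  \sum_i (mderiv i f).@[fun l => ev B x (b l)] * der B x (b i).
Proof.
pose P f := der B x (mmap (cst B) b f) =
  \sum_i (mderiv i f).@[fun l => ev B x (b l)] * der B x (b i).
have evE g : ev B x (mmap (cst B) b g) = g.@[fun l => ev B x (b l)].
  rewrite mevalE /mmap rmorph_sum; apply: eq_bigr => m _.
  rewrite rmorphM ev_cst; congr (_ * _); rewrite rmorph_prod.
  by apply: eq_bigr => i _; rewrite rmorphXn.
have PC c : P c%:MP.
  by rewrite /P mmapC der_cst big1 // => i _; rewrite mderivC meval0 mul0r.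
have PX i : P 'X_i.
  rewrite /P mmapX mmap1U (bigD1 i) //= mderivX mnm1E eqxx scale1r -{1}[U_(i)%MM]add0m addmK.
  rewrite mpolyX0 meval1 mul1r big1 ?addr0 // => l li.
  by rewrite mderivX mnm1E eq_sym (negPf li) scale0r meval0 mul0r.
have PD g1 g2 : P g1 -> P g2 -> P (g1 + g2).
  rewrite /P => P1 P2; rewrite mmapD raddfD /= P1 P2 -big_split; apply: eq_bigr => i _.
  by rewrite mderivD mevalD mulrDl.
have PM g1 g2 : P g1 -> P g2 -> P (g1 * g2).
  rewrite /P => P1 P2; rewrite rmorphM derM P1 P2 !evE.
  rewrite mulr_suml mulr_sumr -big_split; apply: eq_bigr => i _.
  by rewrite mderivM mevalD !mevalM /= mulrDl mulrA; congr (_ + _); rewrite mulrAC.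
have P0 : P 0 by have := PC 0; rewrite mpolyC0.
have P1 : P 1 by have := PC 1; rewrite mpolyC1.
rewrite -/(P f) [f]mpolyE; apply: (big_ind P); [exact: P0 | exact: PD | move=> m _].
rewrite -mul_mpolyC; apply: (PM) => //; rewrite mpolyXE_id.
apply: (big_ind P); [exact: P1 | exact: (PM) | move=> i _].
by elim: (m i) => [|k IH]; [rewrite expr0 | rewrite exprS; exact: PM].
Qed.

End PointwiseDerivation.

(** * Critical points of generic data *)

(** [Y] and [H] are the matrices D and S of the opening comment. Symmetry of [Y] moves it from [w]
    to [q]: q^T w = q^T Y (1 + H) w = (Y q)^T (1 + H) w. *)
Lemma symmetric_jacobian (K : comNzRingType) N m (Y H : 'M[K]_N) (G : 'M_(m, N))
    (C : 'M_(N, m)) (q w : 'cV_N) :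
  H^T = H -> G *m Y^T = 0 -> 1%:M = Y *m (1%:M + H) + C *m G ->
  Y *m q = 0 -> G *m w = 0 -> q^T *m w = 0.
Proof.
move=> HT GY one Yq Gw.
(* Multiplying the third identity by Y^T shows that Y^T is symmetric. *)
have YT : Y^T = Y *m (1%:M + H) *m Y^T.
  by rewrite -[LHS]mul1mx {1}one mulmxDl -[C *m G *m _]mulmxA GY mulmx0 addr0.
have Ysym : Y^T = Y.
  rewrite -[RHS]trmxK [in RHS]YT !trmx_mul trmxK [(_ + _)^T]linearD /= trmx1 HT.
  by rewrite mulmxA -YT.
have -> : w = Y *m ((1%:M + H) *m w).
  by rewrite mulmxA -[LHS]mul1mx {1}one mulmxDl -[C *m G *m _]mulmxA Gw mulmx0 addr0.
by rewrite mulmxA -Ysym -trmx_mul Yq trmx0 mul0mx.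
Qed.

(** Applied to T - y and the Jacobian of the generators, this yields the Lagrange multipliers. *)
Lemma rowspan_orthogonal (K : fieldType) m N (G : 'M[K]_(m, N)) (d : 'rV_N) :
  (forall v : 'cV_N, G *m v = 0 -> d *m v = 0) -> exists c : 'rV_m, d = c *m G.
Proof.
move=> Gd; apply/submxP; rewrite submxE; apply/eqP/matrixP => i j.
have := Gd (col j (cokermx G)).
have -> : G *m col j (cokermx G) = 0 by rewrite colE mulmxA mulmx_coker mul0mx.
by move=> /(_ erefl)/matrixP/(_ i 0); rewrite colE mulmxA -colE mxE => ->; rewrite !mxE.
Qed.

Section GenericDerivative.
Variables (K : numFieldType) (X : Type) (U : set_system X) (UF : UltraFilter U).
Variables (N m : nat) (I J : finType) (alpha : 'I_N -> I) (beta : 'I_N -> J).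
Variables (F : 'I_m -> {mpoly K[N]}).
Variables (T y : X -> 'I_N -> K) (c : X -> 'I_m -> K) (u : X -> I -> K) (z : X -> J -> K).
Hypothesis generic : forall g : {mpoly K[N]}, g != 0 -> U (fun x => g.@[T x] != 0).
Hypothesis Fy : U (fun x => forall l, (F l).@[y x] = 0).
Hypothesis Ty : U (fun x => forall i,
  T x i = y x i + \sum_l c x l * (mderiv i (F l)).@[y x]).
Hypothesis uzy : U (fun x => \sum_i u x (alpha i) * z x (beta i) * y x i = 0).

(** Through [alpha] and [beta], a vector indexed by ['I_N] is read as an I x J matrix. Once y, c, u,
    z are adjoined to the polynomials in T with derivation d/dT_j, the three relations holding
    modulo U can be differentiated. *)
Lemma generic_derivative (j : 'I_N) :
  U (fun x => exists (dy : 'I_N -> K) (dc : 'I_m -> K) (du : I -> K) (dz : J -> K),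
    [/\ forall l, \sum_i (mderiv i (F l)).@[y x] * dy i = 0,
        forall i, (i == j)%:R = dy i + \sum_l (dc l * (mderiv i (F l)).@[y x] +
          c x l * \sum_k (mderiv k (mderiv i (F l))).@[y x] * dy k) &
        \sum_i ((du (alpha i) * z x (beta i) + u x (alpha i) * dz (beta i)) * y x i
          + u x (alpha i) * z x (beta i) * dy i) = 0]).
Proof.
have FU : ProperFilter U by exact: ultra_proper.
pose h (k : ('I_N + 'I_m) + (I + J)) x := match k with
  | inl (inl i) => y x i | inl (inr l) => c x l
  | inr (inl a) => u x a | inr (inr b) => z x b end.
have [C [e [b [eve dere evb]]]] :=
  adjoin_seq UF (base_dring j FU generic) h (enum {: ('I_N + 'I_m) + (I + J)}).
pose Y i := b (inl (inl i)); pose c' l := b (inl (inr l)).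
pose u' a := b (inr (inl a)); pose z' a := b (inr (inr a)).
have evY x i : ev C x (Y i) = y x i by rewrite /Y evb ?mem_enum.
have evc x l : ev C x (c' l) = c x l by rewrite /c' evb ?mem_enum.
have evu x a : ev C x (u' a) = u x a by rewrite /u' evb ?mem_enum.
have evz x a : ev C x (z' a) = z x a by rewrite /z' evb ?mem_enum.
have evT x i : ev C x (e 'X_i) = T x i by rewrite eve /= mevalXU.
have derT x i : der C x (e 'X_i) = (i == j)%:R.
  rewrite dere /= mderivX mnm1E; case: eqP => [->|_]; last by rewrite scale0r meval0.
  by rewrite scale1r -{1}[U_(j)%MM]add0m addmK mpolyX0 meval1.
have evF x (f : {mpoly K[N]}) : ev C x (mmap (cst C) Y f) = f.@[y x].
  rewrite mevalE /mmap rmorph_sum; apply: eq_bigr => k _.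
  rewrite rmorphM ev_cst; congr (_ * _); rewrite rmorph_prod.
  by apply: eq_bigr => i _; rewrite rmorphXn evY.
have derF x (f : {mpoly K[N]}) : der C x (mmap (cst C) Y f) =
    \sum_i (mderiv i f).@[y x] * der C x (Y i).
  rewrite der_mmap; apply: eq_bigr => i _; congr (_ * _).
  by apply: meval_eq => l; rewrite evY.
have d1 : U (fun x => forall l, der C x (mmap (cst C) Y (F l)) = 0).
  apply: filter_forall => l; apply: der_ae0.
  by apply: filterS Fy => x Fx; rewrite evF.
pose G i l := mmap (cst C) Y (mderiv i (F l)).
have d2 : U (fun x => forall i, der C x (e 'X_i - (Y i + \sum_l c' l * G i l)) = 0).
  apply: filter_forall => i; apply: der_ae0.
  apply: filterS Ty => x Tx; rewrite rmorphB evT Tx rmorphD evY rmorph_sum.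
  under [X in _ - (_ + X)]eq_bigr do rewrite rmorphM evc evF.
  by rewrite subrr.
have d3 : U (fun x => der C x (\sum_i u' (alpha i) * z' (beta i) * Y i) = 0).
  apply: der_ae0; apply: filterS uzy => x <-; rewrite rmorph_sum.
  by apply: eq_bigr => i _; rewrite !rmorphM evu evz evY.
apply: filterS3 d1 d2 d3 => x d1 d2 d3.
exists (fun i => der C x (Y i)), (fun l => der C x (c' l)),
  (fun a => der C x (u' a)), (fun a => der C x (z' a)); split=> [l|i|].
- by rewrite -derF.
- have := d2 i; rewrite raddfB /= derT => /eqP; rewrite subr_eq0 => /eqP ->.
  rewrite raddfD raddf_sum; congr (_ + _); apply: eq_bigr => l _.
  by rewrite derM evF evc derF.
- rewrite -[RHS]d3 raddf_sum; apply: eq_bigr => i _.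
  by rewrite !derM rmorphM evu evz evY.
Qed.

(** The first two conditions put [z] in the kernel of y and [u] in its left kernel. Taken at the
    unknown derivatives [du] and [dz], they remove these from the differentiated relation, so D
    kills u (x) z. *)
Lemma generic_contradiction (w : X -> 'I_N -> K) :
  U (fun x => forall phi : I -> K, \sum_i phi (alpha i) * z x (beta i) * y x i = 0) ->
  U (fun x => forall psi : J -> K, \sum_i u x (alpha i) * psi (beta i) * y x i = 0) ->
  U (fun x => forall l, \sum_i (mderiv i (F l)).@[y x] * w x i = 0) ->
  U (fun x => \sum_i u x (alpha i) * z x (beta i) * w x i = 0).
Proof.
have FU : ProperFilter U by exact: ultra_proper.
move=> Uphi Upsi Uw.
have FF : Filter U by exact: filter_filter.
(* There are finitely many directions [j], so one set of U carries all the derivatives. *)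
have Uder := @filter_forall _ _ _ U FF generic_derivative.
have Uphipsi := @filterI _ U FF _ _ Uphi Upsi.
apply: filterS3 Uphipsi Uw Uder => x [phi0 psi0] w0.
move=> /choice[dy /choice[dc /choice[du /choice[dz dP]]]].
pose G : 'M[K]_(m, N) := \matrix_(l, i) (mderiv i (F l)).@[y x].
pose Y : 'M[K]_N := \matrix_(j, i) dy j i.
pose C : 'M[K]_(N, m) := \matrix_(j, l) dc j l.
pose S : 'M[K]_N := \matrix_(k, i) \sum_l c x l * (mderiv k (mderiv i (F l))).@[y x].
pose q : 'cV[K]_N := \col_i (u x (alpha i) * z x (beta i)).
pose W : 'cV[K]_N := \col_i w x i.
have /matrixP/(_ 0 0) : q^T *m W = 0.
  apply: (@symmetric_jacobian _ _ _ Y S G C).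
  - apply/matrixP => i k; rewrite !mxE; apply: eq_bigr => l _.
    by rewrite mderiv_comm.
  - apply/matrixP => l j; rewrite !mxE; have [Fdy _ _] := dP j; rewrite -[RHS](Fdy l).
    by apply: eq_bigr => i _; rewrite !mxE.
  - apply/matrixP => j i; rewrite mulmxDr mulmx1 !mxE eq_sym.
    have [_ -> _] := dP j; rewrite -addrA; congr (_ + _).
    rewrite big_split /= addrC; congr (_ + _).
      rewrite /=; under eq_bigr do rewrite mulr_sumr.
      rewrite exchange_big; apply: eq_bigr => k _; rewrite !mxE mulr_sumr.
      by apply: eq_bigr => l _; rewrite mulrA mulrC.
    by apply: eq_bigr => l _; rewrite !mxE.
  - apply/matrixP => j i; rewrite !mxE.
    have [_ _] := dP j; rewrite big_split /=.
    under eq_bigr do rewrite mulrDl.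
    rewrite big_split /= phi0 psi0 !add0r => qdy; rewrite -[RHS]qdy.
    by apply: eq_bigr => k _; rewrite !mxE mulrC.
  - apply/matrixP => l k; rewrite !mxE -[RHS](w0 l).
    by apply: eq_bigr => i _; rewrite !mxE.
rewrite !mxE => qW; rewrite -[RHS]qW; apply: eq_bigr => i _; by rewrite !mxE.
Qed.
End GenericDerivative.

Section Generic.
Variables (K : numFieldType) (N : nat) (Y : ('I_N -> K) -> Prop).
Variables (I J : finType) (alpha : 'I_N -> I) (beta : 'I_N -> J).

Let vanishing (f : {mpoly K[N]}) := forall t, Y t -> f.@[t] = 0.
Let tangent (y v : 'I_N -> K) :=
  forall f, vanishing f -> \sum_i (mderiv i f).@[y] * v i = 0.

Theorem generic_critical_nondegenerate : exists2 g : {mpoly K[N]}, g != 0 &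
  forall T, g.@[T] != 0 -> forall y, Y y ->
    (forall v, tangent y v -> \sum_i v i * (T i - y i) = 0) ->
  forall (u : I -> K) (z : J -> K) (w : 'I_N -> K),
    (forall phi : I -> K, \sum_i phi (alpha i) * z (beta i) * y i = 0) ->
    (forall psi : J -> K, \sum_i u (alpha i) * psi (beta i) * y i = 0) ->
    tangent y w ->
    \sum_i u (alpha i) * z (beta i) * w i = 0.
Proof.
have [||m [F [FI Fgen]]] := @hilbert_basis K N vanishing.
- by move=> f g f0 g0 t Yt; rewrite mevalD f0 // g0 // addr0.
- by move=> h f f0 t Yt; rewrite mevalM f0 // mulr0.
(* At a point of Y, the Leibniz terms containing a value of some [F l] vanish. *)
have tangentE y v : Y y ->
    (forall l, \sum_i (mderiv i (F l)).@[y] * v i = 0) -> tangent y v.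
  move=> Yy Fv f /Fgen[h ->].
  under eq_bigr => i _.
    rewrite (raddf_sum (mderiv i)) (raddf_sum (meval y)) mulr_suml.
    under eq_bigr => l _ do rewrite /= mderivM mevalD !mevalM (FI l) // mulr0 add0r -mulrA.
    over.
  by rewrite exchange_big big1 // => l _; rewrite -mulr_sumr Fv mulr0.
apply: contrapT => nog.
pose X := (('I_N -> K) * ('I_N -> K) * ('I_m -> K) * (I -> K) * (J -> K) * ('I_N -> K))%type.
pose T (x : X) := x.1.1.1.1.1; pose y (x : X) := x.1.1.1.1.2.
pose c (x : X) := x.1.1.1.2; pose u (x : X) := x.1.1.2.
pose z (x : X) := x.1.2; pose w (x : X) := x.2.
pose bad x := [/\ Y (y x), 
  forall i, T x i = y x i + \sum_l c x l * (mderiv i (F l)).@[y x],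
  forall phi : I -> K, \sum_i phi (alpha i) * z x (beta i) * y x i = 0,
  forall psi : J -> K, \sum_i u x (alpha i) * psi (beta i) * y x i = 0 &
  tangent (y x) (w x) /\ \sum_i u x (alpha i) * z x (beta i) * w x i <> 0].
(* A nonzero [g] is not a witness, so it fails at some datum; the multipliers complete this to a bad
   point. *)
have badP g : g != 0 -> exists2 x, bad x & g.@[T x] != 0.
  move=> g0; apply: contrapT => nox; apply: nog; exists g => // T' gT y' Yy crit u' z' w'.
  move=> phi0 psi0 tw; apply: contrapT => nz.
  pose G : 'M[K]_(m, N) := \matrix_(l, i) (mderiv i (F l)).@[y'].
  have [|c' c'E] := @rowspan_orthogonal _ _ _ G (\row_i (T' i - y' i)).
    move=> v Gv; apply/matrixP => a a'; rewrite !mxE.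
    rewrite -[RHS](crit (fun i => v i a')).
      by apply: eq_bigr => i _; rewrite !mxE mulrC.
    apply: tangentE => // l; have /matrixP/(_ l a') := Gv; rewrite !mxE => Gv0; rewrite -[RHS]Gv0.
    by apply: eq_bigr => i _; rewrite !mxE.
  apply: nox; exists (T', y', fun l => c' 0 l, u', z', w') => //; split=> // i.
  rewrite /T /y /c /=; have /matrixP/(_ 0 i) := c'E.
  rewrite !mxE => /eqP; rewrite subr_eq addrC => /eqP ->; congr (_ + _).
  by apply: eq_bigr => l _; rewrite !mxE.
(* Its members contain all bad data over the nonvanishing locus of some nonzero polynomial. By
   [badP] the filter is proper, and any ultrafilter refining it makes [T] generic and the data
   bad. *)
pose Fil : set_system X := fun A => exists2 g : {mpoly K[N]}, g != 0 &
  forall x, bad x -> g.@[T x] != 0 -> A x.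
have FilP : ProperFilter Fil.
  apply: Build_ProperFilter_ex.
    by move=> A [g /badP[x bx gx] gA]; exists x; exact: gA.
  split.
  - by exists 1; rewrite ?oner_eq0.
  - move=> A B [g g0 gA] [h h0 hB]; exists (g * h); first by rewrite mulf_neq0.
    move=> x bx; rewrite mevalM mulf_eq0 negb_or => /andP[gx hx].
    by split; [exact: gA | exact: hB].
  - by move=> A B AB [g g0 gA]; exists g => // x bx gx; apply/AB/gA.
have [U [UF FU]] := ultraFilterLemma FilP.
have Ubad : U bad by apply: FU; exists 1; rewrite ?oner_eq0.
have PU : ProperFilter U by exact: ultra_proper.
have gen (g : {mpoly K[N]}) : g != 0 -> U (fun x => g.@[T x] != 0).
  by move=> g0; apply: FU; exists g.
have := @generic_contradiction K X U UF N m I J alpha beta F T y c u z gen.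
move=> /(_ _ _ _ w _ _ _) H.
have : U (fun x => \sum_i u x (alpha i) * z x (beta i) * w x i = 0).
  apply: H; apply: filterS Ubad => x [Yy Tx phi0 psi0 [tw _]] //.
  - by move=> l; apply: FI.
  - by move=> l; apply: tw.
move=> U0; apply: (filter_not_empty U); apply: filterS2 Ubad U0.
by move=> x [_ _ _ _ [_]].
Qed.
End Generic.

(** * Points of P_s outside R_s *)

(** Along the line, [f] is a polynomial in t vanishing at every natural number, hence zero, and so
    is its derivative at t = 0. *)
Lemma line_tangent (K : numFieldType) N (f : {mpoly K[N]}) (y w : 'I_N -> K) :
  (forall t, f.@[fun i => y i + t * w i] = 0) ->
  \sum_i (mderiv i f).@[y] * w i = 0.
Proof.
move=> f0.
(* The derivative at 0 of polynomials is a [dring] over a point; with U empty,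
   [der_ae0] is vacuous and [der_mmap] is the plain chain rule. *)
have derM (x : unit) (p q : {poly K}) :
    (horner_eval 0 \o deriv) (p * q) =
    (horner_eval 0 \o deriv) p * horner_eval 0 q + horner_eval 0 p * (horner_eval 0 \o deriv) q.
  by rewrite /= /horner_eval derivM !hornerE.
have evC (x : unit) (c : K) : horner_eval 0 c%:P = c by rewrite /horner_eval hornerC.
have derC (x : unit) (c : K) : (horner_eval 0 \o deriv) c%:P = 0.
  by rewrite /= /horner_eval derivC horner0.
pose U : set_system unit := fun=> False.
have compat (p : {poly K}) : U (fun=> horner_eval 0 p = 0) ->
    U (fun=> (horner_eval 0 \o deriv) p = 0) by [].
pose B : dring K U := @DRing K unit U {poly K} (fun=> horner_eval 0)
  (fun=> horner_eval 0 \o deriv) polyC derM evC derC compat.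
pose b i : B := (y i)%:P + w i *: 'X.
have bE t i : (b i).[t] = y i + t * w i by rewrite /b !hornerE mulrC.
pose p : {poly K} := mmap (cst B) b f.
have p0 : p = 0.
  (* The [size p] distinct roots are one more than the degree allows. *)
  apply: (@roots_geq_poly_eq0 _ _ [seq i%:R | i <- iota 0 (size p)]).
  - apply/allP => _ /mapP[i _ ->]; rewrite /root -[X in _ == X](f0 i%:R).
    rewrite /p /mmap horner_sum mevalE; apply/eqP; apply: eq_bigr => m _.
    rewrite hornerM hornerC; congr (_ * _); rewrite horner_prod.
    by apply: eq_bigr => l _; rewrite horner_exp bE.
  - rewrite map_inj_uniq ?iota_uniq // => i j /eqP.
    by rewrite eqr_nat => /eqP.
  - by rewrite size_map size_iota.
have := der_mmap b f tt; rewrite -/p p0 raddf0 => H; rewrite [RHS]H.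
apply: eq_bigr => i _; congr (_ * _).
  by apply: meval_eq => l; rewrite /= /horner_eval bE mul0r addr0.
by rewrite /= /horner_eval /b derivD derivC derivZ derivX !hornerE.
Qed.

Lemma row_kernel (K : fieldType) p q (A : 'I_p -> 'I_q -> K) :
  (\rank (\matrix_(i, j) A i j) < p)%N ->
  exists2 v : 'I_p -> K, (exists i, v i != 0) &
    forall j, \sum_i v i * A i j = 0.
Proof.
set M := \matrix_(i, j) A i j => rM.
have: kermx M != 0 by rewrite -mxrank_eq0 mxrank_ker subn_eq0 -ltnNge.
move=> /rowV0Pn[v /sub_kermxP vM v0].
exists (v 0).
  apply/existsP; move: v0; apply: contraNT => /existsPn v0.
  by apply/eqP/rowP => i; rewrite mxE; apply/eqP; have := v0 i; rewrite negbK.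
move=> j; have /matrixP/(_ 0 j) := vM; rewrite !mxE => H; rewrite -[RHS]H.
by apply: eq_bigr => i _; rewrite mxE.
Qed.

Lemma sum_sqr_gt0 (R : realFieldType) p (v : 'I_p -> R) i :
  v i != 0 -> 0 < \sum_j v j ^+ 2.
Proof.
move=> vi; rewrite (bigD1 i) //= ltr_pwDl ?exprn_even_gt0 //.
by apply: sumr_ge0 => j _; exact: sqr_ge0.
Qed.

Lemma unit_vec_normalize (R : realType) p (v : 'I_p -> R) :
  0 < \sum_j v j ^+ 2 -> unit_vec (fun j => v j / Num.sqrt (\sum_j v j ^+ 2)).
Proof.
move=> v0; rewrite /unit_vec.
under eq_bigr do rewrite expr_div_n.
by rewrite -mulr_suml sqr_sqrtr ?ltW // divff // gt_eqF.
Qed.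

(** The other q - 1 < p vectors, enumerated by [lift i0], cannot span the space. *)
Lemma unit_vec_orth_others (R : realType) p q (a : 'I_q -> 'I_p -> R) i0 :
  (q <= p)%N ->
  exists2 b : 'I_p -> R, unit_vec b & forall i, i != i0 -> orth b (a i).
Proof.
case: q a i0 => [a []//|q a i0 qp].
have [|v [j0 vj0] vP] := @row_kernel R p q (fun j i => a (lift i0 i) j).
  by rewrite (leq_ltn_trans (rank_leq_col _)).
have v_gt0 := sum_sqr_gt0 vj0.
exists (fun j => v j / Num.sqrt (\sum_j v j ^+ 2)); first exact: unit_vec_normalize.
move=> i; rewrite eq_sym => /unlift_some[i' -> _]; rewrite /orth.
transitivity ((\sum_j v j * a (lift i0 i') j) / Num.sqrt (\sum_j v j ^+ 2)).
  by rewrite mulr_suml; apply: eq_bigr => j _; rewrite mulrAC.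
by rewrite vP mul0r.
Qed.

(** * Sums of products over multi-indices *)

Section Tensors.
Variables (R : realType) (k : nat) (n : 'I_k -> nat).

(** Distributivity when the index type depends on the factor: the sums are taken over tagged
    indices, and [fprod] leads back to multi-indices. *)
Lemma sum_prod_midx (F : forall l, 'I_(n l) -> R) :
  \sum_(x : midx n) \prod_l F l (x l) = \prod_l \sum_j F l j.
Proof.
pose P l : {ffun 'I_(n l) -> R} := [ffun j => F l j].
under [RHS]eq_bigr => l _ do rewrite (big_tag F l).
rewrite bigA_distr_big_dep.
transitivity (\sum_(t : fprod (fun l => 'I_(n l)) | predT (fprod_fun t)) \prod_l P l (t l)).
  rewrite (reindex (@dffun_of_fprod _ _)); last exact/onW_bij/dffun_of_fprod_bij.
  by apply: eq_bigr => t _; apply: eq_bigr => l _; rewrite !ffunE.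
rewrite (big_fprod_dep _ _ P); apply: eq_big => [g|g _]; first by rewrite andbT.
apply: eq_bigr => l _.
by congr untag; apply: funext => j; rewrite ffunE.
Qed.

Lemma sum_prod_split l0 (phi : 'I_(n l0) -> R) (F : forall l, 'I_(n l) -> R) :
  \sum_(x : midx n) phi (x l0) * \prod_(l | l != l0) F l (x l) =
  (\sum_j phi j) * \prod_(l | l != l0) \sum_j F l j.
Proof.
have := sum_prod_midx (dfwith F phi); rewrite (bigD1 l0) //= dfwith_in.
rewrite [X in _ = _ * X -> _](eq_bigr (fun l => \sum_j F l j)); last first.
  by move=> l ll0; rewrite dfwith_out // eq_sym.
move=> <-; apply: eq_bigr => x _; rewrite [in RHS](bigD1 l0) //= dfwith_in.
by congr (_ * _); apply: eq_bigr => l ll0; rewrite dfwith_out // eq_sym.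
Qed.

(** [psi (reset d l0 x)] encodes a function psi of the coordinates of x other than
    the one of mode l0. *)
Definition reset (d : midx n) (l0 : 'I_k) (x : midx n) : midx n :=
  [ffun l => if l == l0 then d l else x l].

Lemma prod_reset d l0 x (F : forall l, 'I_(n l) -> R) :
  \prod_(l | l != l0) F l (reset d l0 x l) = \prod_(l | l != l0) F l (x l).
Proof. by apply: eq_bigr => l /negPf ll0; rewrite ffunE ll0. Qed.

Lemma midx_eqE (x x' : midx n) : (x == x')%:R = \prod_l (x l == x' l)%:R :> R.
Proof.
case: eqP => [->|ne]; first by rewrite big1 // => l _; rewrite eqxx.
have [l /negPf xl] : exists l, x l != x' l.
  apply: contrapT => noL; apply: ne; apply/ffunP => l; apply/eqP.
  by apply: contrapT => /negP xl; apply: noL; exists l.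
by rewrite (bigD1 l) //= xl mul0r.
Qed.

(** Expanding [psi] in indicators of multi-indices, which factor over the modes, splits off the sum
    of [phi] as a factor. *)
Lemma sum_reset d l0 (phi : 'I_(n l0) -> R) (psi : midx n -> R)
    (F : forall l, 'I_(n l) -> R) :
  \sum_j phi j = 0 ->
  \sum_(x : midx n) phi (x l0) * psi (reset d l0 x) * \prod_(l | l != l0) F l (x l) = 0.
Proof.
move=> phi0.
pose E (x' : midx n) l (j : 'I_(n l)) : R := (j == x' l)%:R * F l j.
transitivity (\sum_(x : midx n) \sum_x' phi (x l0) * (psi x' * (d l0 == x' l0)%:R) *
    \prod_(l | l != l0) E x' l (x l)).
  apply: eq_bigr => x _.
  rewrite [psi _](_ : _ = \sum_x' psi x' * (reset d l0 x == x')%:R); last first.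
    rewrite (bigD1 (reset d l0 x)) //= eqxx mulr1 big1 ?addr0 // => x'.
    by rewrite eq_sym => /negPf ->; rewrite mulr0.
  rewrite mulr_sumr mulr_suml; apply: eq_bigr => x' _.
  rewrite midx_eqE (bigD1 l0) //= ffunE eqxx big_split /= !mulrA; congr (_ * _ * _).
  by apply: eq_bigr => l /negPf ll0; rewrite ffunE ll0.
rewrite exchange_big big1 // => x' _.
under eq_bigr => x _ do rewrite mulrAC.
rewrite -mulr_suml sum_prod_split phi0 !mul0r //.
Qed.

(** * Flattenings of points of P_s outside R_s *)

Variables (s r : nat).

(** Orthogonality in mode [m] makes the products of the [a l i] over l != l0 pair with [z] to
    [zeta i]. The flattening thus sends [z] to the sum of the [zeta i * sigma i * a l0 i], which is
    0. The weights [zeta i] restrict the orthogonality to the vectors that occur in [z]. *)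
Lemma flattening_witness d (l0 m : 'I_k) (sigma zeta : 'I_r -> R)
    (a : forall l : 'I_k, 'I_r -> 'I_(n l) -> R) (u b : 'I_(n l0) -> R) (i0 : 'I_r) :
  m != l0 -> (forall l i, unit_vec (a l i)) ->
  (forall i i', i != i' -> zeta i * (\sum_j a m i j * a m i' j) = 0) ->
  (forall j, \sum_i zeta i * sigma i * a l0 i j = 0) ->
  (forall i, sigma i * (\sum_j u j * a l0 i j) = 0) ->
  let y := cp_tensor sigma a in
  let z (x : midx n) := \sum_i zeta i * \prod_(l | l != l0) a l i (x l) in
  let w (x : midx n) := b (x l0) * \prod_(l | l != l0) a l i0 (x l) in
  [/\ forall phi : _ -> R, \sum_(x : midx n) phi (x l0) * z (reset d l0 x) * y x = 0,
      forall psi : _ -> R, \sum_(x : midx n) u (x l0) * psi (reset d l0 x) * y x = 0 &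
      \sum_(x : midx n) u (x l0) * z (reset d l0 x) * w x = (\sum_j u j * b j) * zeta i0].
Proof.
move=> ml0 a1 orthm ker0 u0 y z w.
have yE x : y x = \sum_i sigma i * a l0 i (x l0) * \prod_(l | l != l0) a l i (x l).
  by apply: eq_bigr => i _; rewrite (bigD1 l0) //= mulrA.
have zE x : z (reset d l0 x) = z x.
  by apply: eq_bigr => i _; rewrite (prod_reset d l0 x (fun l => a l i)).
have gram i i' : zeta i * \prod_(l | l != l0) (\sum_j a l i j * a l i' j) =
    zeta i * (i == i')%:R.
  case: eqP => [<-|/eqP ii'].
    by congr (_ * _); apply: big1 => l _; rewrite -[RHS](a1 l i); apply: eq_bigr => j _.
  by rewrite (bigD1 m) //= mulrA orthm // mul0r mulr0.
have pair phi b' i' :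
    \sum_(x : midx n) phi (x l0) * z x * (b' (x l0) * \prod_(l | l != l0) a l i' (x l)) =
    (\sum_j phi j * b' j) * zeta i'.
  transitivity (\sum_i zeta i * \sum_(x : midx n) phi (x l0) * b' (x l0) *
      \prod_(l | l != l0) (a l i (x l) * a l i' (x l))).
    under [RHS]eq_bigr do rewrite mulr_sumr.
    rewrite exchange_big; apply: eq_bigr => x _; rewrite mulrAC /z mulr_sumr.
    apply: eq_bigr => i _; rewrite big_split /=; ring.
  under eq_bigr => i _.
    rewrite (@sum_prod_split l0 (fun j => phi j * b' j) (fun l j => a l i j * a l i' j)).
    rewrite mulrCA gram mulrA.
    over.
  by rewrite (bigD1 i') //= eqxx mulr1 [X in _ + X]big1 ?addr0 // => i /negPf ->; rewrite mulr0.
split=> [phi|psi|].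
- under eq_bigr => x _ do rewrite zE yE mulr_sumr.
  rewrite exchange_big /=.
  under eq_bigr => i _.
    under eq_bigr => x _ do rewrite mulrA.
    under eq_bigr => x _ do rewrite -mulrA.
    rewrite (pair phi (fun j => sigma i * a l0 i j) i) mulr_suml.
    over.
  rewrite exchange_big big1 // => j _.
  transitivity (phi j * \sum_i zeta i * sigma i * a l0 i j); last by rewrite ker0 mulr0.
  by rewrite mulr_sumr; apply: eq_bigr => i _; ring.
- under eq_bigr => x _ do rewrite yE mulr_sumr.
  rewrite exchange_big big1 // => i _.
  rewrite -[RHS](@sum_reset d l0 (fun j => sigma i * (u j * a l0 i j)) psi (fun l => a l i)).
    by apply: eq_bigr => x _; ring.
  by rewrite -mulr_sumr u0.
- by under eq_bigr => x _ do rewrite zE; exact: pair.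
Qed.


Lemma cp_tensorD1 (sigma : 'I_r -> R) (a : forall l : 'I_k, 'I_r -> 'I_(n l) -> R) i0 x :
  cp_tensor sigma a x = sigma i0 * \prod_l a l i0 (x l) +
    \sum_(i | i != i0) sigma i * \prod_l a l i (x l).
Proof. by rewrite /cp_tensor (bigD1 i0). Qed.

(** [z] lies in the kernel of the mode [l0] flattening of y and [u] is orthogonal to its image. The
    last two conditions give a line in P_s whose direction is not tangent to the matrices of the
    same rank. *)
Definition flattening_defect (d : midx n) (y : tensor R n) (l0 : 'I_k)
    (u : 'I_(n l0) -> R) (z : midx n -> R) (w : tensor R n) :=
  [/\ forall phi : _ -> R, \sum_(x : midx n) phi (x l0) * z (reset d l0 x) * y x = 0,
      forall psi : _ -> R, \sum_(x : midx n) u (x l0) * psi (reset d l0 x) * y x = 0,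
      forall t, Ps s r (fun x => y x + t * w x) &
      \sum_(x : midx n) u (x l0) * z (reset d l0 x) * w x != 0].

(** As sigma i0 = 0, the i0-th vector of the second mode may be replaced by one
    orthogonal to the others even when s = 1. *)
Lemma defect_zero_weight d (sigma : 'I_r -> R)
    (a : forall l : 'I_k, 'I_r -> 'I_(n l) -> R) i0 :
  (1 < k)%N -> (0 < s)%N -> (forall l : 'I_k, (r <= n l)%N) ->
  P_decomp s sigma a -> sigma i0 = 0 ->
  exists l0 (u : 'I_(n l0) -> R) z w, flattening_defect d (cp_tensor sigma a) u z w.
Proof.
move=> k1 s0 rn [a1 aorth] si0.
(* The first mode is orthogonal since s > 0, so its [i0]-th vector is orthogonal to the image of the
   flattening. The second mode serves for the orthogonality in [z]. *)
pose l0 : 'I_k := Ordinal (ltnW k1); pose m : 'I_k := Ordinal k1.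
have ml0 : m != l0 by [].
have [b b1 borth] := unit_vec_orth_others (a m) i0 (rn m).
pose a' (l : 'I_k) i := if i == i0 then dfwith (fun l => a l i0) b l else a l i.
have a'1 l i : unit_vec (a' l i).
  by rewrite /a'; case: ifP => // _; case: dfwithP => // l' _; exact: a1.
have a'i0 l i : i != i0 -> a' l i = a l i by rewrite /a' => /negPf ->.
have orthC p (f g : 'I_p -> R) : orth f g -> orth g f.
  by move=> fg; rewrite /orth -[RHS]fg; apply: eq_bigr => j _; rewrite mulrC.
have a'orth (l : 'I_k) i : (l < s)%N || (l == m) -> i != i0 -> orth (a' l i0) (a' l i).
  move=> lsm ii0; rewrite (a'i0 l i) // /a' eqxx.
  move: lsm; case: dfwithP => [_|l' ml']; first exact: borth.
  by rewrite eq_sym (negPf ml') orbF => l's; apply: aorth; rewrite // eq_sym.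
have P' (sigma' : 'I_r -> R) : P_decomp s sigma' a'.
  split=> // l i i' ls ii'; have [ii0|ii0] := eqVneq i i0.
    by rewrite ii0; apply: a'orth; rewrite ?ls // eq_sym -ii0.
  have [i'i0|i'i0] := eqVneq i' i0.
    by rewrite i'i0; apply/orthC/a'orth; rewrite ?ls.
  by rewrite !a'i0 //; exact: aorth.
have yE : cp_tensor sigma a = cp_tensor sigma a'.
  apply: funext => x; rewrite !(cp_tensorD1 _ _ i0) si0 !mul0r; congr (_ + _).
  by apply: eq_bigr => i ii0; congr (_ * _); apply: eq_bigr => l _; rewrite a'i0.
(* Here [w] is the [i0]-th rank one term, so adding t w changes the weight of [i0] from 0 to t. *)
have := @flattening_witness d l0 m sigma (fun i => (i == i0)%:R) a' (a' l0 i0) (a' l0 i0) i0.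
rewrite -yE; set z := fun x => _; set w := fun x => _.
case=> // [i i' ii'|j|i|H1 H2 H3].
- case: eqP => [ii0|_]; last by rewrite mul0r.
  by rewrite mul1r ii0; apply: a'orth; rewrite ?eqxx ?orbT // eq_sym -ii0.
- by apply: big1 => i _; case: eqP => [->|_]; rewrite ?si0 ?(mulr0, mul0r).
- have [->|ii0] := eqVneq i i0; first by rewrite si0 mul0r.
  by rewrite a'orth ?mulr0 ?s0.
exists l0, (a' l0 i0), z, w; split=> // [t|]; last first.
  rewrite H3 eqxx mulr1.
  under eq_bigr do rewrite -expr2.
  by rewrite (a'1 l0 i0) oner_neq0.
exists (fun i => if i == i0 then t else sigma i), a'; split=> //.
rewrite yE; apply: funext => x; rewrite !(cp_tensorD1 _ _ i0) si0 mul0r add0r eqxx addrC.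
congr (_ + _); first by rewrite /w [in RHS](bigD1 l0).
by apply: eq_bigr => i /negPf ->.
Qed.

(** A linear relation [c] among the vectors of mode [l0] gives [z], and a vector orthogonal to all
    of them gives [u]. As l0 >= s, that mode carries no orthogonality constraint, so its [i0]-th
    vector may move along [u]. *)
Lemma defect_rank d (sigma : 'I_r -> R)
    (a : forall l : 'I_k, 'I_r -> 'I_(n l) -> R) (l0 : 'I_k) :
  (1 < k)%N -> (0 < s <= l0)%N -> (r <= n l0)%N ->
  P_decomp s sigma a -> (forall i, sigma i != 0) ->
  \rank (\matrix_(j < n l0, i < r) a l0 i j) != r ->
  exists (u : 'I_(n l0) -> R) z w, flattening_defect d (cp_tensor sigma a) u z w.
Proof.
move=> k1 /andP[s0 sl0] rn [a1 aorth] sigma0; set M := \matrix_(j, i) _ => rankM.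
have rM : (\rank M < r)%N by rewrite ltn_neqAle rankM rank_leq_col.
pose m : 'I_k := Ordinal (ltnW k1).
have ml0 : m != l0 by apply: contraTneq sl0 => <-; rewrite -ltnNge.
have [u [ju uj] uorth] := @row_kernel R _ _ (fun j i => a l0 i j) (leq_trans rM rn).
have [|c [i0 ci0] cker] := @row_kernel R _ _ (fun i j => a l0 i j).
  by rewrite -mxrank_tr (_ : _^T = M) //; apply/matrixP => j i; rewrite !mxE.
have u_gt0 := sum_sqr_gt0 uj.
have := @flattening_witness d l0 m sigma (fun i => c i / sigma i) a u u i0.
set y := cp_tensor _ _; set z := fun x => _; set w := fun x => _.
case=> // [i i' ii'|j|i|H1 H2 H3].
- by rewrite aorth ?mulr0.
- rewrite -[RHS](cker j); apply: eq_bigr => i _; congr (_ * _).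
  by rewrite divfK.
- by rewrite uorth mulr0.
exists u, z, w; split=> // [t|]; last first.
  rewrite H3; under eq_bigr do rewrite -expr2.
  by rewrite !mulf_neq0 ?invr_eq0 // gt_eqF.
(* The new [i0]-th vector of mode [l0] before normalization; its norm becomes the weight. It is
   nonzero because [u] is orthogonal to [a l0 i0] and [sigma i0] is nonzero. *)
pose v j := sigma i0 * a l0 i0 j + t * u j.
have v_gt0 : 0 < \sum_j v j ^+ 2.
  have -> : \sum_j v j ^+ 2 = sigma i0 ^+ 2 * (\sum_j a l0 i0 j ^+ 2) +
     (2 * sigma i0 * t) * (\sum_j u j * a l0 i0 j) + t ^+ 2 * (\sum_j u j ^+ 2).
    rewrite !mulr_sumr -!big_split /=; apply: eq_bigr => j _; rewrite /v; ring.
  rewrite uorth mulr0 addr0 (a1 l0 i0) mulr1 ltr_pwDl ?exprn_even_gt0 ?sigma0 //.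
  by rewrite mulr_ge0 ?sqr_ge0 // ltW.
set rho := Num.sqrt (\sum_j v j ^+ 2).
have rho0 : rho != 0 by rewrite gt_eqF // sqrtr_gt0.
pose b j := v j / rho.
have b1 : unit_vec b by exact: (unit_vec_normalize v_gt0).
pose a' (l : 'I_k) i := if i == i0 then dfwith (fun l => a l i0) b l else a l i.
have a'E l i : l != l0 -> a' l i = a l i.
  by move=> ll0; rewrite /a'; case: eqP => // ->; rewrite dfwith_out // eq_sym.
exists (fun i => if i == i0 then rho else sigma i), a'; split; first split.
- move=> l i; rewrite /a'; case: ifP => // _; case: dfwithP => // l' _; exact: a1.
- move=> l i i' ls ii'; have ll0 : l != l0.
    by apply: contraTneq ls => ->; rewrite -leqNgt.
  by rewrite !a'E //; exact: aorth.
apply: funext => x; rewrite /y !(cp_tensorD1 _ _ i0) eqxx addrAC; congr (_ + _).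
  rewrite [in LHS](bigD1 l0) //= [in RHS](bigD1 l0) //= /w ?mulrA -mulrDl; congr (_ * _).
    by rewrite /a' eqxx dfwith_in /b [RHS]mulrC divfK.
  by apply: eq_bigr => l ll0; rewrite a'E.
apply: eq_bigr => i /negPf ii0; rewrite ii0; congr (_ * _).
by apply: eq_bigr => l _; rewrite /a' ii0.
Qed.

Lemma defect_exists d (y : tensor R n) :
  (1 < k)%N -> (0 < s)%N -> (forall l : 'I_k, (r <= n l)%N) ->
  Ps s r y -> ~ Rs s r y ->
  exists l0 (u : 'I_(n l0) -> R) z w, flattening_defect d y u z w.
Proof.
move=> k1 s0 rn [sigma [a [Pa ->]]] notR.
have [[i si]|sigma0] := pselect (exists i, sigma i = 0).
  exact: defect_zero_weight Pa si.
have {}sigma0 i : sigma i != 0 by apply/eqP => si; apply: sigma0; exists i.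
have [l0 [sl0 /eqP rl0]] : exists l0 : 'I_k, (s <= l0)%N /\
    \rank (\matrix_(j < n l0, i < r) a l0 i j) <> r.
  apply: contrapT => noL; apply: notR; exists sigma, a; split=> // l sl.
  by apply: contrapT => rl; apply: noL; exists l.
exists l0; apply: defect_rank => //; by rewrite s0.
Qed.

End Tensors.

Unset Implicit Arguments.

Theorem theorem3p16 (R : realType) (k s : nat) (n : 'I_k -> nat) (r : nat) :
  (3 <= k)%N -> (1 <= s <= k)%N ->
  (forall l : 'I_k, (0 < n l)%N) ->
  (forall l : 'I_k, (r <= n l)%N) ->
  exists g : tpoly R n, g != 0 /\
    forall T : tensor R n, teval g T != 0 ->
      forall y : tensor R n, critical_projection (@Ps R k n s r) T y ->
        @Rs R k n s r y.
Proof.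
move=> k3 /andP[s1 _] n0 rn.
pose d : midx n := [ffun l => Ordinal (n0 l)].
pose Y (t : 'I_#|midx n| -> R) := exists2 T : tensor R n, Ps s r T & t = tvec T.
(* Flattening in mode [l0]: rows are indexed by the [l0]-th coordinate, columns by the others
   through [reset]. *)
have gen l0 := @generic_critical_nondegenerate R #|midx n| Y 'I_(n l0) (midx n)
  (fun i => (enum_val i : midx n) l0) (fun i => reset d l0 (enum_val i)).
pose g l0 := s2val (cid2 (gen l0)).
have g0 l0 : g l0 != 0 by rewrite /g; case: cid2.
have gP l0 := s2valP' (cid2 (gen l0)).
(* The mode of the defect depends on y, hence the product over all modes. *)
exists (\prod_l0 g l0); split; first by apply/prodf_neq0 => l0 _.
move=> T gT y [Py crit]; apply: contrapT => notR.
have [l0 [u [z [w [H1 H2 line nz]]]]] := defect_exists d (ltnW k3) s1 rn Py notR.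
have sumE (f : midx n -> R) : \sum_(i < #|midx n|) f (enum_val i) = \sum_x f x.
  rewrite [RHS](reindex (fun i : 'I_#|midx n| => enum_val i)) //.
  by apply: onW_bij; exists enum_rank; [exact: enum_valK | exact: enum_rankK].
have gl0 : (g l0).@[tvec T] != 0.
  by move: gT; rewrite /teval rmorph_prod => /prodf_neq0/(_ l0 isT).
apply/negP: nz; apply/negPn/eqP.
have := gP l0 _ gl0 (tvec y) _ _ u z (tvec w).
rewrite -sumE; apply.
- by exists y.
- move=> v tv; pose V : tensor R n := fun x => v (enum_rank x).
  have VE : tvec V = v by apply: funext => i; rewrite /tvec /V enum_valK.
  have := crit V; rewrite /hs -sumE => H; rewrite -[RHS]H.
    by apply: eq_bigr => i _; rewrite /V enum_valK.
  by move=> f fI; rewrite VE; apply: tv => _ [T' PT' ->]; exact: fI.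
- by move=> phi; rewrite -[RHS](H1 phi) -sumE.
- by move=> psi; rewrite -[RHS](H2 psi) -sumE.
- move=> f fI; apply: line_tangent => t; apply: fI.
  by exists (fun x => y x + t * w x).
Qed.
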